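(* There is an absolute constant $C>0$ such that for every finite set $A\subseteq\mathbb{R}$ with $|A|\ge 4$, the set $g(A)=\{g(a,b,c,d): a,b,c,d\in A \text{ pairwise distinct}\}$, where $g(a,b,c,d)=X(a,b,c,d)$ is the cross ratio, satisfies $$|g(A)|\ \ge\ C\,|A|^2.$$
   Context: For pairwise distinct $a,b,c,d\in\mathbb{R}$ the cross ratio is the real number $$X(a,b,c,d)=\frac{(a-b)(c-d)}{(b-c)(a-d)}.$$ It is defined only for pairwise distinct arguments. Here $|S|$ denotes the cardinality of a finite set $S$. *)

(* Defs.v *)
From mathcomp Require Import all_boot all_order all_algebra finmap.
From mathcomp Require Import boolp classical_sets functions cardinality reals.

Set Implicit Arguments.
Unset Strict Implicit.
Unset Printing Implicit Defensive.

Import GRing.Theory Num.Theory.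
Local Open Scope classical_set_scope.
Local Open Scope ring_scope.

(* Total by the convention 0^-1 = 0; only used below on pairwise distinct
   arguments, where the denominator is nonzero. *)
Definition cross_ratio (R : realType) (a b c d : R) : R :=
  ((a - b) * (c - d)) / ((b - c) * (a - d)).

Definition cross_ratio_set (R : realType) (A : set R) : set R :=
  [set x | exists a b c d : R,
     [/\ A a, A b, A c & A d] /\ uniq [:: a; b; c; d] /\
     x = cross_ratio a b c d].

(* [fset_set] is the empty set on infinite sets, so this finiteness is what makes
   [#|` fset_set (cross_ratio_set A)|] the cardinality of [cross_ratio_set A]. *)
Lemma finite_cross_ratio_set (R : realType) (A : set R) :
  finite_set A -> finite_set (cross_ratio_set A).
Proof.
move=> finA.
pose f (p : (R * R) * (R * R)) := cross_ratio p.1.1 p.1.2 p.2.1 p.2.2.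
apply: (@sub_finite_set _ _ (f @` ((A `*` A) `*` (A `*` A)))).
  move=> x [a [b [c [d [[Aa Ab Ac Ad] [_ ->]]]]]].
  by exists ((a, b), (c, d)).
by apply: finite_image; apply: finite_setX; apply: finite_setX.
Qed.

(* Main.v *)
(* Count the pairs of increasing quadruples of A with equal cross ratio. Such a
   pair is related by an orientation-preserving Moebius map T, all four points
   lying on one increasing branch of its graph, so there are at most
   sum_T r(T)^4 of them, with r(T) the number of points of A x A on the branch.
   Following Solymosi and Tardos, consecutive triples of points on a branch span
   few indices of A in total, so by convexity the sum over them of gap^-3 is at
   least of order r(T)^4 / |A|^3; as three points determine T, these triples are
   distinct for distinct T, and the sum of gap^-3 over all triples is O(|A|^3).
   Hence there are O(|A|^6) such pairs, and Cauchy-Schwarz gives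
   |g(A)| >> |A|^8 / |A|^6. *)
Require Import Defs.
From mathcomp Require Import all_boot all_order all_algebra finmap.
From mathcomp Require Import boolp classical_sets functions cardinality reals.
From mathcomp Require Import ring lra zify.

Set Implicit Arguments.
Unset Strict Implicit.
Unset Printing Implicit Defensive.

Import Order.TTheory GRing.Theory Num.Theory.

Local Open Scope ring_scope.

(** * Increasing branches of Moebius graphs *)

(* The branch, to the right or to the left of the pole according to the sign of
   [p], of the graph of [x |-> - (q x + s) / (p x + r)]; it increases when
   [0 < p * s - q * r]. *)
Definition mobius_branch {R : realFieldType} (p q r s x y : R) : bool :=
  (p * x * y + q * x + r * y + s == 0) && (0 < p * x + r).

(** The difference quotient of a Moebius map, cleared of denominators. Its signs give monotonicity
    on one branch and later tell the two branches apart. *)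
Lemma mobius_slope {R : realFieldType} (p q r s x1 y1 x2 y2 : R) :
  p * x1 * y1 + q * x1 + r * y1 + s = 0 ->
  p * x2 * y2 + q * x2 + r * y2 + s = 0 ->
  (y2 - y1) * ((p * x1 + r) * (p * x2 + r)) = (p * s - q * r) * (x2 - x1).
Proof.
move=> e1 e2.
have -> : s = - (p * x1 * y1 + q * x1 + r * y1) by lra.
have h : (p * x2 + r) * y2 = - (q * x2) + (p * x1 * y1 + q * x1 + r * y1) by
  lra.
transitivity ((p * x1 + r) * ((p * x2 + r) * y2)
  - y1 * ((p * x1 + r) * (p * x2 + r))); first by ring.
by rewrite h; ring.
Qed.

Lemma mobius_branch_ltE {R : realFieldType} (p q r s x1 y1 x2 y2 : R) :
  0 < p * s - q * r -> mobius_branch p q r s x1 y1 ->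
  mobius_branch p q r s x2 y2 -> (y1 < y2) = (x1 < x2).
Proof.
move=> D /andP[/eqP e1 d1] /andP[/eqP e2 d2].
by rewrite -subr_gt0 -(pmulr_lgt0 _ (mulr_gt0 d1 d2)) (mobius_slope e1 e2)
  pmulr_rgt0 // subr_gt0.
Qed.

Lemma quadratic_eq0 {R : realFieldType} (u v w x1 x2 x3 x : R) :
  x1 < x2 -> x2 < x3 ->
  u * x1 ^+ 2 + v * x1 + w = 0 -> u * x2 ^+ 2 + v * x2 + w = 0 ->
  u * x3 ^+ 2 + v * x3 + w = 0 -> u * x ^+ 2 + v * x + w = 0.
Proof.
move=> l12 l23 e1 e2 e3.
have f12 : u * (x1 + x2) + v = 0.
  have : (x2 - x1) * (u * (x1 + x2) + v) = 0 by lra.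
  by move/eqP; rewrite mulf_eq0 subr_eq0 gt_eqF //= => /eqP.
have f23 : u * (x2 + x3) + v = 0.
  have : (x3 - x2) * (u * (x2 + x3) + v) = 0 by lra.
  by move/eqP; rewrite mulf_eq0 subr_eq0 gt_eqF //= => /eqP.
have : (x3 - x1) * u = 0 by lra.
move/eqP; rewrite mulf_eq0 subr_eq0 gt_eqF ?(lt_trans l12) //= => /eqP u0.
have v0 : v = 0 by move: f12; rewrite u0; lra.
by move: e1; rewrite u0 v0; lra.
Qed.

(** Equating the two maps gives a quadratic in the abscissa; three common points make it vanish
    identically, so the maps agree. Monotonicity then settles the branch. *)
Lemma mobius_branch_sub {R : realFieldType}
    (p q r s p' q' r' s' x1 x2 x3 y1 y2 y3 x y : R) :
  0 < p * s - q * r -> 0 < p' * s' - q' * r' -> x1 < x2 -> x2 < x3 ->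
  mobius_branch p q r s x1 y1 -> mobius_branch p' q' r' s' x1 y1 ->
  mobius_branch p q r s x2 y2 -> mobius_branch p' q' r' s' x2 y2 ->
  mobius_branch p q r s x3 y3 -> mobius_branch p' q' r' s' x3 y3 ->
  mobius_branch p q r s x y -> mobius_branch p' q' r' s' x y.
Proof.
move=> D D' l12 l23 b1 b1' b2 b2' b3 b3' b.
have root z t : mobius_branch p q r s z t -> mobius_branch p' q' r' s' z t ->
   (q * p' - q' * p) * z ^+ 2 + (q * r' + s * p' - q' * r - s' * p) * z
     + (s * r' - s' * r) = 0.
  move=> /andP[/eqP e d] /andP[/eqP e' d'].
  transitivity ((q * z + s) * (p' * z + r') - (q' * z + s') * (p * z + r)).
    by ring.
  have -> : q * z + s = - t * (p * z + r) by lra.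
  have -> : q' * z + s' = - t * (p' * z + r') by lra.
  by ring.
have Q := quadratic_eq0 x l12 l23 (root _ _ b1 b1')
  (root _ _ b2 b2') (root _ _ b3 b3').
have /andP[/eqP e d] := b; have /andP[/eqP e1' d1'] := b1'.
have e' : p' * x * y + q' * x + r' * y + s' = 0.
  have : (p * x + r) * (p' * x * y + q' * x + r' * y + s') = 0.
    have -> : (p * x + r) * (p' * x * y + q' * x + r' * y + s') =
      (p * x * y + q * x + r * y + s) * (p' * x + r') -
      ((q * p' - q' * p) * x ^+ 2 + (q * r' + s * p' - q' * r - s' * p) * x
     + (s * r' - s' * r)) by ring.
    by rewrite e Q; ring.
  by move/eqP; rewrite mulf_eq0 gt_eqF //= => /eqP.
rewrite /mobius_branch e' eqxx /=.
(* If [p' * x + r' <= 0], the slope identity of the second map is incompatible with the sign that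
   the first branch gives to [y - y1]. *)
case: (ltgtP x x1) => [lx|lx|->//]; rewrite ltNge; apply/negP => d'.
- have ly : y < y1 by rewrite (mobius_branch_ltE D b b1).
  have : 0 < (p' * s' - q' * r') * (x1 - x) by rewrite mulr_gt0 // subr_gt0.
  rewrite -(mobius_slope e' e1') ltNge => /negP; apply.
  by rewrite mulr_ge0_le0 ?subr_ge0 ?(ltW ly) // mulr_le0_ge0 // ltW.
- have ly : y1 < y by rewrite (mobius_branch_ltE D b1 b).
  have : 0 < (p' * s' - q' * r') * (x - x1) by rewrite mulr_gt0 // subr_gt0.
  rewrite -(mobius_slope e1' e') ltNge => /negP; apply.
  by rewrite mulr_ge0_le0 ?subr_ge0 ?(ltW ly) // mulr_ge0_le0 // ltW.
Qed.

Lemma mobius_branch_exists {R : realType} (x1 x2 x3 x4 y1 y2 y3 y4 : R) :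
  x1 < x2 -> x2 < x3 -> x3 < x4 -> y1 < y2 -> y2 < y3 -> y3 < y4 ->
  cross_ratio x1 x2 x3 x4 = cross_ratio y1 y2 y3 y4 ->
  exists p q r s : R, 0 < p * s - q * r /\
    [/\ mobius_branch p q r s x1 y1, mobius_branch p q r s x2 y2,
        mobius_branch p q r s x3 y3 & mobius_branch p q r s x4 y4].
Proof.
move=> lx1 lx2 lx3 ly1 ly2 ly3 X.
set al := (x2 - x1) * (y3 - y2); set be := (y2 - y1) * (x3 - x2).
have al0 : 0 < al by rewrite mulr_gt0 // subr_gt0.
have be0 : 0 < be by rewrite mulr_gt0 // subr_gt0.
have e4 : al * (x4 - x3) * (y4 - y1) = be * (y4 - y3) * (x4 - x1).
  have nz (a b c d : R) : a < b -> b < c -> c < d -> (b - c) * (a - d) != 0.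
    by move=> ab bc cd; rewrite mulf_neq0 // subr_eq0 lt_eqF //; lra.
  move/eqP: X; rewrite /cross_ratio eqr_div ?nz // => /eqP X.
  by rewrite /al /be; lra.
(* Coefficients of [be * (x - x1) * (y - y3) - al * (x - x3) * (y - y1)]: it vanishes at points 1
   and 3 by its form, at point 2 by the choice of [al] and [be], at point 4 by [e4]. *)
exists (be - al), (al * y1 - be * y3), (al * x3 - be * x1),
  (be * y3 * x1 - al * x3 * y1).
split.
  have -> : (be - al) * (be * y3 * x1 - al * x3 * y1)
    - (al * y1 - be * y3) * (al * x3 - be * x1)
     = al * be * ((x3 - x1) * (y3 - y1)) by ring.
  rewrite !mulr_gt0 // subr_gt0; lra.
have p31 : 0 < x3 - x1 by lra.
split; apply/andP; split.
- by apply/eqP; ring.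
- have := mulr_gt0 al0 p31; lra.
- by apply/eqP; rewrite /al /be; ring.
- have h1 : 0 < be * (x2 - x1) by rewrite mulr_gt0 // subr_gt0.
  have h2 : 0 < al * (x3 - x2) by rewrite mulr_gt0 // subr_gt0.
  lra.
- by apply/eqP; ring.
- have := mulr_gt0 be0 p31; lra.
- by apply/eqP; lra.
(* The denominator is [be * (x - x1) + al * (x3 - x)], clearly positive on [[x1, x3]]. At [x4], its
   product with [y4 - y3] is [al * (x4 - x3) * (y3 - y1)] by [e4]. *)
- have p43 : 0 < y4 - y3 by lra.
  rewrite -(pmulr_rgt0 _ p43).
  have : 0 < al * (x4 - x3) * (y3 - y1) by rewrite !mulr_gt0 // subr_gt0; lra.
  lra.
Qed.

(** * Chains in the index grid and the gaps of their triples *)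

Definition lt2 {n} (P Q : 'I_n * 'I_n) : bool := (P.1 < Q.1)%N && (P.2 < Q.2)%N.

Definition chain {n} (S : {set 'I_n * 'I_n}) : Prop :=
  {in S &, forall P Q, P != Q -> lt2 P Q || lt2 Q P}.

Definition triple n : finType :=
  ('I_n * 'I_n * ('I_n * 'I_n) * ('I_n * 'I_n))%type.

Definition ordered {n} (t : triple n) : bool :=
  lt2 t.1.1 t.1.2 && lt2 t.1.2 t.2.

Definition inside {n} (S : {set 'I_n * 'I_n}) (t : triple n) : bool :=
  [&& t.1.1 \in S, t.1.2 \in S & t.2 \in S].

(** On ordered triples, where no subtraction is truncated, this is the taxicab distance between the
    outer points. *)
Definition gap {n} (t : triple n) : nat :=
  ((t.2.1 - t.1.1.1) + (t.2.2 - t.1.1.2))%N.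

Lemma ordered_gap_gt0 n (t : triple n) : ordered t -> (0 < gap t)%N.
Proof. by case: t => [[[x1 y1] [x2 y2]] [x3 y3]];
  rewrite /ordered /lt2 /gap /=; lia. Qed.

(** The first point has [n ^ 2] choices. Both offsets of the second and the horizontal offset of the
    third are below [g]; the gap then fixes the remaining offset. *)
Lemma card_ordered_gap n g :
  (#|[set t : triple n | ordered t & gap t == g]| <= n ^ 2 * g ^ 3)%N.
Proof.
case: g => [|g].
  rewrite exp0n // muln0 leqn0 cards_eq0; apply/eqP/setP => t; rewrite !inE.
  by apply/negP => /andP[/ordered_gap_gt0 h /eqP e]; rewrite e in h.
pose f (t : triple n) := (t.1.1, ((inord (t.1.2.1 - t.1.1.1) : 'I_g.+1,
   inord (t.1.2.2 - t.1.1.2) : 'I_g.+1), inord (t.2.1 - t.1.1.1) : 'I_g.+1)).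
rewrite -(@card_in_imset _ _ f); last first.
  move=> [[[x1 y1] [x2 y2]] [x3 y3]] [[[x1' y1'] [x2' y2']] [x3' y3']].
  rewrite !inE /ordered /lt2 /gap /= => h h' [ex1 ey1].
  subst x1' y1'.
  move=> /(congr1 val); rewrite /= !inordK; [|lia..] => ex2.
  move=> /(congr1 val); rewrite /= !inordK; [|lia..] => ey2.
  move=> /(congr1 val); rewrite /= !inordK; [|lia..] => ex3.
  by congr (_, (_, _), (_, _)); apply/val_inj => /=; lia.
by rewrite (leq_trans (max_card _)) // !card_prod !card_ord; lia.
Qed.

(** Each gap value contributes at most [n ^ 2], and every gap is below [2 * n]. *)
Lemma sum_ordered_gap (K : realFieldType) n :
  \sum_(t : triple n | ordered t) ((gap t)%:R ^+ 3)^-1 <= 2 * n%:R ^+ 3 :> K.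
Proof.
case: n => [|n].
  by rewrite big1 ?mulr_ge0 ?exprn_ge0 // => -[[[[]]]].
rewrite (partition_big (fun t : triple n.+1 =>
  inord (gap t) : 'I_(2 * n.+1)%N.-1.+1) predT) //=.
apply: (@le_trans _ _ (\sum_(g : 'I_(2 * n.+1)%N.-1.+1) n.+1%:R ^+ 2));
  last first.
  rewrite sumr_const card_ord -(mulr_natl (_ ^+ 2)).
  have -> : (2 * n.+1).-1.+1%:R = 2 * n.+1%:R :> K by rewrite -natrM;
    congr (_%:R); lia.
  by lra.
apply: ler_sum => g _.
have E : forall t : triple n.+1,
  ordered t && (inord (gap t) == g :> 'I_(2 * n.+1)%N.-1.+1)
   = (ordered t && (gap t == g)).
  move=> t; rewrite -val_eqE /= inordK // /gap.
  have := ltn_ord t.2.1; have := ltn_ord t.2.2; lia.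
rewrite (eq_bigl _ _ E).
rewrite (eq_bigr (fun=> ((g%:R : K) ^+ 3)^-1));
  last by move=> t /andP[_ /eqP->].
have -> : \sum_(t : triple n.+1 | ordered t && (gap t == g))
  ((g%:R : K) ^+ 3)^-1
  = (#|[set t : triple n.+1 | ordered t & gap t == g]|)%:R *
    ((g%:R : K) ^+ 3)^-1.
  by rewrite mulr_natl -sumr_const; apply: eq_bigl => t; rewrite !inE.
(* At gap 0 the convention [0^-1 = 0] kills the term. *)
have [g0|g0] := posnP g.
  by rewrite g0 expr0n invr0 mulr0 exprn_ge0.
rewrite ler_pdivrMr ?exprn_gt0 ?ltr0n // -!natrX -natrM ler_nat.
exact: card_ordered_gap.
Qed.

(** Jensen's inequality for the inverse cube: the extreme case is all terms equal to [s / m]. *)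
Lemma sum_inv_cube_ge (K : realFieldType) (m : nat) (s : K) (g : 'I_m -> nat) :
  0 < s -> (forall j, (0 < g j)%N) -> (\sum_j (g j))%:R <= s ->
  m%:R ^+ 4 / s ^+ 3 <= \sum_j (((g j)%:R : K) ^+ 3)^-1.
Proof.
move=> s0 g0 gs; have [m0|m0] := posnP m.
  rewrite [X in X%:R ^+ 4]m0 expr0n mul0r; apply: sumr_ge0 => j _.
  by rewrite invr_ge0 exprn_ge0.
have M0 : 0 < m%:R :> K by rewrite ltr0n.
(* the tangent line at [s / m] of the convex function [x |-> x ^- 3] *)
have T (x : K) : 0 < x ->
    4 * (m%:R / s) ^+ 3 - 3 * (m%:R / s) ^+ 4 * x <= (x ^+ 3)^-1.
  move=> x0; rewrite -[X in _ <= X]mul1r ler_pdivlMr ?exprn_gt0 //.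
  set v := m%:R / s * x.
  have -> : (4 * (m%:R / s) ^+ 3 - 3 * (m%:R / s) ^+ 4 * x) * x ^+ 3
    = 4 * v ^+ 3 - 3 * v ^+ 4 by rewrite /v; ring.
  (* This product expands to [1 - 4 * v ^+ 3 + 3 * v ^+ 4]. *)
  have : 0 <= (v - 1) ^+ 2 * (3 * v ^+ 2 + 2 * v + 1).
    by rewrite mulr_ge0 ?sqr_ge0 // !addr_ge0 // mulr_ge0 ?sqr_ge0 //
       /v !mulr_ge0 ?invr_ge0 ?ltW.
  lra.
apply: (@le_trans _ _ (\sum_j (4 * (m%:R / s) ^+ 3 - 3 * (m%:R / s) ^+ 4 *
  (g j)%:R))).
  rewrite sumrB sumr_const card_ord -(mulr_natl (_ * _)) -mulr_sumr -natr_sum.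
  set G := (_ : nat)%:R in gs *.
  have : 3 * (m%:R / s) ^+ 4 * G <= 3 * (m%:R / s) ^+ 4 * s.
    by rewrite ler_pM2l // mulr_gt0 // exprn_gt0 // divr_gt0.
  have -> : 3 * (m%:R / s) ^+ 4 * s = 3 * (m%:R ^+ 4 / s ^+ 3).
    by field; rewrite gt_eqF.
  have -> : m%:R * (4 * (m%:R / s) ^+ 3) = 4 * (m%:R ^+ 4 / s ^+ 3).
    by field; rewrite gt_eqF.
  lra.
by apply: ler_sum => j _; apply: T; rewrite ltr0n.
Qed.

(** Telescoping with step two; the monotonicity hypothesis keeps the natural subtractions exact. *)
Lemma sum_two_steps (f : nat -> nat) m :
  (forall j, (j < m)%N -> (f j <= f j.+2)%N) ->
  (\sum_(j < m) (f j.+2 - f j) + (f 0%N + f 1%N) = f m + f m.+1)%N.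
Proof.
elim: m => [|m IH] h; first by rewrite big_ord0.
rewrite big_ord_recr /=.
have := h m (ltnSn m); have := IH (fun j jm => h j (ltnW jm)).
move: (\sum_(j < m) _)%N => X; lia.
Qed.

(** Only the [#|S| - 2] triples of consecutive points are kept. Their gaps overlap at most twice in
    each coordinate, so they total at most [4 * n], and convexity applies. *)
Lemma chain_sum_gap (K : realFieldType) n (S : {set 'I_n * 'I_n}) :
  chain S -> (2 < #|S|)%N ->
  (#|S| - 2)%:R ^+ 4 / (4 * n%:R) ^+ 3
    <= \sum_(t | ordered t && inside S t) ((gap t)%:R ^+ 3)^-1 :> K.
Proof.
move=> chS; set r := #|S| => S2.
have [P0 _] : exists P0 : 'I_n * 'I_n,
  P0 \in S by apply/card_gt0P/(ltn_trans _ S2).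
pose le1 := [rel P Q : 'I_n * 'I_n | (P.1 <= Q.1)%N].
pose s := sort le1 (enum S).
have sz : size s = r by rewrite size_sort -cardE.
have us : uniq s by rewrite sort_uniq enum_uniq.
have ms P : (P \in s) = (P \in S) by rewrite mem_sort mem_enum.
have ss : pairwise le1 s.
  rewrite -sorted_pairwise; last by move=> ? ? ?; apply: leq_trans.
  by apply: sort_sorted => ? ?; apply: leq_total.
(* The sort is weak and sees the first coordinate only; the chain property makes it strict in
   both. *)
have lt_s i j : (i < j)%N -> (j < r)%N -> lt2 (nth P0 s i) (nth P0 s j).
  move=> ij jr; have ir := ltn_trans ij jr; rewrite -sz in ir jr.
  have /(pairwiseP P0)/(_ i j ir jr ij) /= := ss.
  have : nth P0 s i != nth P0 s j by rewrite nth_uniq // ltn_eqF.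
  have [Si Sj] : nth P0 s i \in S /\ nth P0 s j \in S by rewrite -!ms !mem_nth.
  by move/(chS _ _ Si Sj)/orP => [//|/andP[lt_ji _]]; rewrite leqNgt lt_ji.
pose t (j : 'I_(r - 2)) : triple n :=
  (nth P0 s j, nth P0 s j.+1, nth P0 s j.+2).
have tP j : ordered (t j) && inside S (t j).
  have j2 := ltn_ord j.
  by rewrite /ordered /inside /= -!ms !mem_nth ?lt_s ?sz //; lia.
have t_inj : injective t.
  move=> i j [/eqP + _ _]; have i2 := ltn_ord i; have j2 := ltn_ord j.
  rewrite nth_uniq ?sz //; [|lia..].
  by move=> /eqP; apply: val_inj.
apply: (@le_trans _ _ (\sum_j ((gap (t j))%:R ^+ 3)^-1)); last first.
  rewrite -(big_imset (h := t) (A := predT) (fun u => ((gap u)%:R ^+ 3)^-1)) /=;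
    last by move=> i j _ _; apply: t_inj.
  rewrite [leRHS](bigID (mem (t @: predT))) /= -[leLHS]addr0 lerD //.
    rewrite le_eqVlt; apply/orP; left; apply/eqP; apply: eq_bigl => u.
    apply/imsetP/andP => [[j _ ->]|[_ /imsetP//]]; split=> //.
    exact: imset_f.
  by rewrite sumr_ge0 // => u _; rewrite invr_ge0 exprn_ge0.
apply: sum_inv_cube_ge => [|j|]; first by rewrite mulr_gt0 // ltr0n;
  case: (P0.1) => /=; lia.
  by case/andP: (tP j) => /ordered_gap_gt0.
rewrite -natrM ler_nat big_split /=.
(* For one coordinate, the sum telescopes to the last two values minus the first two. *)
have h (f : 'I_n * 'I_n -> 'I_n) : (forall P Q, lt2 P Q -> (f P < f Q)%N) ->
  (\sum_(j < r - 2) (f (nth P0 s j.+2) - f (nth P0 s j)) <= 2 * n)%N.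
  move=> fm; have /= := @sum_two_steps (fun j => f (nth P0 s j)) (r - 2).
  have := ltn_ord (f (nth P0 s (r - 2))).
  have := ltn_ord (f (nth P0 s (r - 2).+1)).
  set X := (\sum_(_ < _) _)%N.
  move=> h1 h2 /(_ _); rewrite -/X => h3.
  suff : (X + (f (nth P0 s 0) + f (nth P0 s 1)) =
     f (nth P0 s (r - 2)) + f (nth P0 s (r - 2).+1))%N by lia.
  by apply: h3 => j jr; apply/ltnW/fm/lt_s; lia.
rewrite (leq_trans (leq_add (h fst _) (h snd _))) //; last by rewrite -mulnDl.
- by move=> P Q /andP[].
- by move=> P Q /andP[].
Qed.

(** No ordered triple lies in two members of [F], so the lower bounds for the single chains add up
    to at most the sum over all triples. *)
Lemma sum_chain_card (K : realFieldType) n (F : {set {set 'I_n * 'I_n}}) :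
  (forall S, S \in F -> chain S) ->
  (forall S S' t, S \in F -> S' \in F -> ordered t -> inside S t ->
     inside S' t -> S = S') ->
  \sum_(S in F | (3 < #|S|)%N) #|S|%:R ^+ 4 <= 2048 * n%:R ^+ 6 :> K.
Proof.
move=> chF F_inj.
have [n0|n0] := posnP n.
  rewrite big1 ?mulr_ge0 ?exprn_ge0 // => S /andP[_ h].
  have := leq_trans h (max_card _).
  by rewrite card_prod card_ord [X in (X * _)%N]n0.
have N0 : 0 < n%:R :> K by rewrite ltr0n.
apply: (@le_trans _ _ (\sum_(S in F | (3 < #|S|)%N) (1024 * n%:R ^+ 3 *
   \sum_(t | ordered t && inside S t) ((gap t)%:R ^+ 3)^-1))).
  apply: ler_sum => S /andP[SF S3].
  have := chain_sum_gap K (chF _ SF) (ltnW S3).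
  rewrite ler_pdivrMr ?exprn_gt0 ?mulr_gt0 //.
  set W := \sum_(_ | _) _ => h.
  (* From [3 < #|S|] follows [#|S| <= 2 * (#|S| - 2)]; the cost [2 ^ 4] times [4 ^ 3] gives
     [1024]. *)
  apply: (@le_trans _ _ (16 * (#|S| - 2)%:R ^+ 4)); last by lra.
  have -> : 16 = 2 ^+ 4 :> K by ring.
  rewrite -exprMn -natrM lerXn2r ?nnegrE // ler_nat; lia.
rewrite -mulr_sumr.
have -> : 2048 * n%:R ^+ 6 = 1024 * n%:R ^+ 3 * (2 * n%:R ^+ 3) :> K by ring.
rewrite ler_pM2l; last by rewrite mulr_gt0 // exprn_gt0.
apply: le_trans (sum_ordered_gap K n).
rewrite (exchange_big_dep (@ordered n)) /=; last by move=> S t _ /andP[].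
apply: ler_sum => t ot.
rewrite sumr_const -[leRHS]mulr1n ler_wpMn2l ?invr_ge0 ?exprn_ge0 //.
apply/card_le1_eqP => S S' /andP[/andP[SF _] /andP[_ iS]]
  /andP[/andP[SF' _] /andP[_ iS']].
exact: (F_inj S' S t).
Qed.

(** * Cauchy-Schwarz over the fibres of a map *)

Lemma sum_nat_sqr_le (I : Type) (s : seq I) (N : I -> nat) :
  ((\sum_(v <- s) N v) ^ 2 <= size s * \sum_(v <- s) N v ^ 2)%N.
Proof.
have e : (\sum_(v <- s) \sum_(w <- s) (N v ^ 2 + N w ^ 2) =
    2 * (size s * \sum_(v <- s) N v ^ 2))%N.
  under eq_bigr do rewrite big_split /= big_const_seq count_predT iter_addn_0
    mulnC.
  by rewrite big_split /= big_const_seq count_predT iter_addn_0 -big_distrr /=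
    mulnC addnn mul2n.
rewrite -(@leq_pmul2l 2) // -e -mulnn big_distrlr /= big_distrr /=.
apply: leq_sum => v _; rewrite big_distrr /=; apply: leq_sum => w _.
exact: nat_Cauchy.
Qed.

(** With [N v] the size of the fibre over [v], [#|D|] is the sum of the [N v] and the collisions
    number the sum of their squares. *)
Lemma card_sqr_le_collisions (T : finType) (U : eqType) (f : T -> U)
  (D : {set T}) :
  (#|D| ^ 2 <= size (undup (map f (enum D)))
     * #|[set u : T * T | [&& u.1 \in D, u.2 \in D & f u.1 == f u.2]]|)%N.
Proof.
set s := undup _.
pose N v := (\sum_(x in D) (f x == v))%N.
have one x : x \in D -> (\sum_(v <- s) (f x == v) = 1)%N.
  move=> xD; have xs : f x \in s by rewrite mem_undup map_f // mem_enum.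
  rewrite (bigD1_seq (f x)) ?undup_uniq //= eqxx big1 // => v.
  by rewrite eq_sym => /negbTE->.
have -> : #|D| = (\sum_(v <- s) N v)%N.
  by rewrite exchange_big /= -sum1_card; apply: eq_bigr => x /one.
suff -> : #|[set u : T * T | [&& u.1 \in D, u.2 \in D & f u.1 == f u.2]]|
    = (\sum_(v <- s) N v ^ 2)%N by exact: sum_nat_sqr_le.
under [RHS]eq_bigr do rewrite -mulnn big_distrlr /=.
rewrite exchange_big /=.
under [RHS]eq_bigr do rewrite exchange_big /=.
rewrite (pair_big (mem D) (mem D)) /= -sum1_card [LHS]big_mkcond
  [RHS]big_mkcond /=.
apply: eq_bigr => -[x y] _ /=; rewrite inE /=.
have [xD|//] := boolP (x \in D); have [yD|//] := boolP (y \in D) => /=.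
have [fxy|fxy] := eqVneq (f x) (f y).
  by rewrite -(one y yD) fxy; apply: eq_bigr => v _; case: eqP.
by rewrite big1 // => v _; case: eqP => // <-; rewrite eq_sym (negbTE fxy).
Qed.

(** * Increasing quadruples and the graphs carrying their collisions *)

Definition quad n : finType := ('I_n * 'I_n * 'I_n * 'I_n)%type.

Definition increasing {n} (q : quad n) : bool :=
  [&& q.1.1.1 < q.1.1.2, q.1.1.2 < q.1.2 & q.1.2 < q.2]%N.

(** The count is the binomial coefficient ['C(n, 4)], at least [(n / 4) ^ 4], with equality at
    [n = 4]. *)
Lemma card_increasing n : (4 <= n)%N ->
  (n ^ 4 <= 256 * #|[set q : quad n | increasing q]|)%N.
Proof.
move=> n4; apply: (@leq_trans (256 * 'C(n, 4))); last first.
  rewrite leq_pmul2l // -card_ltn_sorted_tuples.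
  pose g (t : 4.-tuple 'I_n) : quad n := (tnth t ord0, tnth t (inord 1),
    tnth t (inord 2), tnth t (inord 3)).
  have gE (i j k l : 'I_n) : g [tuple i; j; k; l] = (i, j, k, l).
    by rewrite /g !(tnth_nth i) /= !inordK.
  have tE (t : 4.-tuple 'I_n) : exists i j k l, t = [tuple i; j; k; l].
    case/tupleP: t => i t; case/tupleP: t => j t; case/tupleP: t => k t.
    by case/tupleP: t => l t; exists i, j, k, l; rewrite (tuple0 t);
      apply: val_inj.
  rewrite -(@card_imset _ _ g); last first.
    move=> t t'; have [i [j [k [l ->]]]] := tE t;
      have [i' [j' [k' [l' ->]]]] := tE t'.
    by rewrite !gE => -[-> -> -> ->].
  apply: subset_leq_card; apply/fintype.subsetP => q /imsetP[t].
  have [i [j [k [l ->]]]] := tE t.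
  by rewrite !inE gE /= => /and4P[h1 h2 h3 _] ->; rewrite /increasing /= h1 h2.
rewrite -(@leq_pmul2r 24) // -mulnA (bin_ffact n 4) !ffactnS ffactn0 /=.
case: n n4 => [|[|[|[|n]]]] // _ /=; nia.
Qed.

(** Points are recorded by index because gaps count positions in the enumeration [a], not real
    distances. *)
Definition mobius_graph {R : realFieldType} {n} (a : 'I_n -> R) (p q r s : R) :
    {set 'I_n * 'I_n} :=
  [set P | mobius_branch p q r s (a P.1) (a P.2)].

(** On an increasing branch the two coordinates compare alike, so equal first indices force equal
    second ones. *)
Lemma mobius_graph_chain {R : realFieldType} n (a : 'I_n -> R) (p q r s : R) :
  {mono a : i j / (i < j)%N >-> i < j} -> 0 < p * s - q * r ->
  chain (mobius_graph a p q r s).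
Proof.
move=> am D [i j] [i' j']; rewrite !inE /= => b b'.
rewrite xpair_eqE /lt2 /= -!am (mobius_branch_ltE D b b')
  (mobius_branch_ltE D b' b).
rewrite !andbb !am -neq_ltn => ne; apply: contraNN ne => /eqP/val_inj ii.
rewrite ii eqxx /=; have := mobius_branch_ltE D b b'; have :=
  mobius_branch_ltE D b' b.
rewrite ii !am ltnn => /negbT + /negbT; rewrite -!leqNgt => h1 h2.
by rewrite -val_eqE eqn_leq h1 h2.
Qed.

Lemma mobius_graph_inj {R : realFieldType} n (a : 'I_n -> R)
    (p q r s p' q' r' s' : R) (t : triple n) :
  {mono a : i j / (i < j)%N >-> i < j} ->
  0 < p * s - q * r -> 0 < p' * s' - q' * r' -> ordered t ->
  inside (mobius_graph a p q r s) t -> inside (mobius_graph a p' q' r' s') t ->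
  mobius_graph a p q r s = mobius_graph a p' q' r' s'.
Proof.
case: t => [[[i1 j1] [i2 j2]] [i3 j3]] am D D'
  /andP[/andP[/= l12 _] /andP[/= l23 _]].
rewrite -!am in l12 l23.
rewrite /inside !inE /= => /and3P[b1 b2 b3] /and3P[b1' b2' b3'].
apply/setP => -[i j]; rewrite !inE /=; apply/idP/idP.
  exact: mobius_branch_sub D D' l12 l23 b1 b1' b2 b2' b3 b3'.
exact: mobius_branch_sub D' D l12 l23 b1' b1 b2' b2 b3' b3.
Qed.

Definition quad_cross_ratio {R : realType} {n} (a : 'I_n -> R) (q : quad n) :
  R :=
  cross_ratio (a q.1.1.1) (a q.1.1.2) (a q.1.2) (a q.2).

Lemma card_cross_ratio_collisions {R : realType} n (a : 'I_n -> R) :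
  {mono a : i j / (i < j)%N >-> i < j} ->
  #|[set u : quad n * quad n | [&& u.1 \in [set q | increasing q],
      u.2 \in [set q | increasing q] &
      quad_cross_ratio a u.1 == quad_cross_ratio a u.2]]|%:R
    <= 2048 * n%:R ^+ 6 :> R.
Proof.
move=> am; set E := [set u : quad n * quad n | _].
(* Maps with the same trace on the grid are identified, which makes the family finite. *)
pose F := [set S : {set 'I_n * 'I_n} | `[< exists p q r s : R,
  0 < p * s - q * r /\ S = mobius_graph a p q r s >]].
have FP S : S \in F -> exists p q r s : R,
    0 < p * s - q * r /\ S = mobius_graph a p q r s by rewrite inE => /asboolP.
have F_chain S : S \in F -> chain S.
  by move=> /FP[p [q [r [s [d ->]]]]]; apply: mobius_graph_chain.
have F_inj S S' t : S \in F -> S' \in F -> ordered t -> inside S t ->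
    inside S' t -> S = S'.
  move=> /FP[p [q [r [s [d ->]]]]] /FP[p' [q' [r' [s' [d' ->]]]]].
  exact: mobius_graph_inj.
apply: (le_trans _ (sum_chain_card R F_chain F_inj)).
(* Two quadruples are regrouped into the four grid points that a common map must carry. *)
pose pts (u : quad n * quad n) :=
  ((u.1.1.1.1, u.2.1.1.1), (u.1.1.1.2, u.2.1.1.2),
  (u.1.1.2, u.2.1.2), (u.1.2, u.2.2)).
pose box (S : {set 'I_n * 'I_n}) :=
  finset.setX (finset.setX (finset.setX S S) S) S.
have pts_inj : injective pts.
  by move=> [[[[? ?] ?] ?] [[[? ?] ?] ?]] [[[[? ?] ?] ?] [[[? ?] ?] ?]]
    [-> -> -> -> -> -> -> ->].
under eq_bigr do rewrite -natrX.
rewrite -natr_sum ler_nat -sum1_card.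
apply: (@leq_trans (\sum_(u in E) \sum_(S in F | (3 < #|S|)%N)
  (pts u \in box S))%N).
  apply: leq_sum => -[[[[i1 i2] i3] i4] [[[j1 j2] j3] j4]].
  rewrite !inE /increasing /= =>
    /and3P[/and3P[li1 li2 li3] /and3P[lj1 lj2 lj3] /eqP X].
  have := X; rewrite /quad_cross_ratio /=;
    move: (li1) (li2) (li3) (lj1) (lj2) (lj3).
  rewrite -!am => ai1 ai2 ai3 aj1 aj2 aj3.
  move/(mobius_branch_exists ai1 ai2 ai3 aj1 aj2 aj3) =>
    [p [q [r [s [d [b1 b2 b3 b4]]]]]].
  pose S := mobius_graph a p q r s.
  have SF : S \in F by rewrite inE; apply/asboolP; exists p, q, r, s.
  have inS : {subset [:: (i1, j1); (i2, j2); (i3, j3); (i4, j4)] <= enum S}.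
    by move=> P; rewrite mem_enum !inE => /or4P[] /eqP-> /=.
  have S3 : (3 < #|S|)%N.
    rewrite cardE; apply: leq_trans (uniq_leq_size _ inS) => //.
    apply: (@map_uniq _ _ (fun P => val P.1)).
    by apply: (sorted_uniq ltn_trans ltnn); rewrite /= li1 li2 li3.
  have boxS : pts (i1, i2, i3, i4, (j1, j2, j3, j4)) \in box S.
    by rewrite /box /pts !finset.in_setX /= !inE /= b1 b2 b3 b4.
  rewrite (bigD1 S) /=; last by rewrite SF.
  by rewrite boxS.
(* For fixed [S], injectivity of [pts] leaves at most [#|S| ^ 4] pairs. *)
rewrite exchange_big /=; apply: leq_sum => S _.
have -> : (#|S| ^ 4 = #|box S|)%N by rewrite !cardsX; ring.
apply: (@leq_trans (\sum_(u | pts u \in box S) 1)%N).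
  rewrite [leqLHS]big_mkcond [leqRHS]big_mkcond /=.
  by apply: leq_sum => u _; case: (u \in E); case: (pts u \in box S).
rewrite sum1_card -(card_imset _ pts_inj); apply: subset_leq_card.
by apply/fintype.subsetP => P /imsetP[u + ->].
Qed.

(** The bounds chain as [n ^ 8 <= 2 ^ 16 * #|D| ^ 2 <= 2 ^ 16 * m * E <= 2 ^ 27 * m * n ^ 6], where
    [2 ^ 27] is [256 ^ 2 * 2048]. *)
Lemma card_quad_cross_ratio {R : realType} n (a : 'I_n -> R) : (4 <= n)%N ->
  {mono a : i j / (i < j)%N >-> i < j} ->
  (2 ^+ 27)^-1 * n%:R ^+ 2 <= (size (undup (map (quad_cross_ratio a)
    (enum [set q : quad n | increasing q]))))%:R :> R.
Proof.
move=> n4 am.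
have := card_cross_ratio_collisions am.
have := card_sqr_le_collisions (quad_cross_ratio a)
  [set q : quad n | increasing q].
have := card_increasing n4.
set D := [set _ | _]; set m := size _; set E :=
  #|[set u : quad n * quad n | _]| => hD hm hE.
have n0 : 0 < n%:R :> R by rewrite ltr0n; lia.
rewrite mulrC ler_pdivrMr ?exprn_gt0 // -(ler_pM2r (exprn_gt0 6 n0)).
apply: (@le_trans _ _ ((256 * #|D|)%:R ^+ 2)).
  rewrite -exprD (_ : 2 + 6 = 4 * 2)%N // exprM -!natrX ler_nat.
  by rewrite leq_exp2r.
rewrite -natrX expnMn natrM.
apply: (@le_trans _ _ ((256 ^ 2)%:R * (m%:R * E%:R))).
  by rewrite ler_pM2l ?ltr0n // -natrM ler_nat.
apply: (@le_trans _ _ ((256 ^ 2)%:R * (m%:R * (2048 * n%:R ^+ 6)))).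
  by rewrite !ler_wpM2l.
rewrite le_eqVlt; apply/orP; left; apply/eqP; rewrite natrX; ring.
Qed.

(** * Transfer to finite sets of reals *)

Local Open Scope classical_set_scope.
Local Open Scope fset_scope.
Local Open Scope ring_scope.

Theorem theorem2 (R : realType) :
  exists C : R, 0 < C /\
    forall A : set R, finite_set A -> (4 <= #|` fset_set A|)%N ->
      C * (#|` fset_set A|)%:R ^+ 2
        <= (#|` fset_set (cross_ratio_set A)|)%:R.
Proof.
exists (2 ^+ 27)^-1; split; first by rewrite invr_gt0 exprn_gt0.
move=> A finA A4; set n := #|` fset_set A|.
pose s := sort <=%R (fset_set A : seq R).
have sz : size s = n by rewrite size_sort.
have ss : sorted <%R s by rewrite sort_lt_sorted fset_uniq.
pose a (i : 'I_n) := nth 0 s i.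
have am : {mono a : i j / (i < j)%N >-> i < j}.
  by move=> i j; rewrite /a lt_sorted_ltn_nth // inE sz.
have aA i : A (a i).
  have : a i \in s by rewrite mem_nth ?sz.
  by rewrite mem_sort in_fset_set // inE.
apply: le_trans (card_quad_cross_ratio A4 am) _.
(* Cross ratios of increasing quadruples are among those counted, which suffices for a lower
   bound. *)
rewrite ler_nat; apply: uniq_leq_size (undup_uniq _) _ => x.
rewrite mem_undup => /mapP[[[[i j] k] l]]; rewrite mem_enum inE /increasing /=.
move=> /and3P[ij jk kl] ->.
rewrite in_fset_set; last exact: finite_cross_ratio_set.
rewrite inE; exists (a i), (a j), (a k), (a l); split=> //; split=> //.
apply: (sorted_uniq lt_trans ltxx); rewrite /= !am ij jk kl //.
Qed.
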